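(* Let $\sigma$ be a simplicial and non-regular cone of dimension $d\ge3$. Then there exists an indecomposable $M$-graded maximal Cohen-Macaulay $\mathbb{K}[\sigma_M]$-module of rank $d-1$.
   Context: $\mathbb{K}$ is a field, $M\cong\mathbb{Z}^d$ is a lattice, $N$ its dual lattice, $\sigma\subset N\otimes_{\mathbb{Z}}\mathbb{R}$ a strictly convex rational polyhedral cone of dimension $d$ (full-dimensional), and $\sigma_M=\check\sigma\cap M$, where $\check\sigma\subset M\otimes_{\mathbb Z}\mathbb{R}$ is the dual cone. $\sigma$ is simplicial if it is generated by $d$ rays, and regular if the primitive generators of its rays form part of a $\mathbb{Z}$-basis of $N$. $\mathbb{K}[\sigma_M]$ is the monoid ring with its natural $M$-grading. Indecomposable refers to the category of $M$-graded modules with degree-preserving homomorphisms. A nonzero finitely generated $M$-graded module $E$ is maximal Cohen-Macaulay iff $H^i_xE=0$ for all $i<d$, where $x$ is the torus fixed point of $\operatorname{spec}(\mathbb{K}[\sigma_M])$ (the maximal graded ideal generated by the non-constant monomials). *)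

(* Defs.v *)
From HB Require Import structures.
From mathcomp Require Import all_boot all_order all_algebra.
From mathcomp Require Import boolp reals.
From mathcomp.multinomials Require Import monalg.

Set Implicit Arguments.
Unset Strict Implicit.
Unset Printing Implicit Defensive.

Import Order.TTheory GRing.Theory Num.Theory.
Local Open Scope ring_scope.

(* Coordinates are fixed on the lattices: M = Z^d and N = Z^d, dual to each   *)
(* other through the dot product, so that M_R = N_R = R^d.                    *)

Definition dot (R : realType) (d : nat) (u v : 'rV[R]_d) : R :=
  \sum_i u 0 i * v 0 i.

Definition lattice_vec (R : realType) (d : nat) (m : 'rV[int]_d) : 'rV[R]_d :=
  map_mx intr m.

Definition cone_hull (R : realType) (d k : nat) (g : 'I_k -> 'rV[int]_d)
    (v : 'rV[R]_d) : Prop :=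
  exists2 c : 'I_k -> R,
    (forall i, 0 <= c i) & v = \sum_i c i *: lattice_vec R (g i).

(* Strictly convex rational polyhedral cones in N_R of full dimension. The    *)
(* last field says that the linear span of the cone has dimension d.          *)
Record cone (R : realType) (d : nat) := Cone {
  cone_set :> 'rV[R]_d -> Prop;
  cone_rational_polyhedral : exists k (g : 'I_k -> 'rV[int]_d),
    forall v, cone_set v <-> cone_hull g v;
  cone_strictly_convex : forall v, cone_set v -> cone_set (- v) -> v = 0;
  cone_full_dimensional : exists2 B : 'M[R]_d,
    row_free B & forall i, cone_set (row i B)
}.

Definition dual_cone (R : realType) (d : nat) (sigma : cone R d)
    (u : 'rV[R]_d) : Prop :=
  forall v, sigma v -> 0 <= dot u v.

Definition primitive (d : nat) (n : 'rV[int]_d) : Prop :=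
  forall (k : int) (w : 'rV[int]_d), n = k *: w -> k \is a GRing.unit.

(* n is primitive and R_{>=0} n is a face of sigma, a face being the zero     *)
(* locus in sigma of some u in the dual cone.                                 *)
Definition ray_generator (R : realType) (d : nat) (sigma : cone R d)
    (n : 'rV[int]_d) : Prop :=
  primitive n /\
  exists2 u : 'rV[R]_d, dual_cone sigma u &
    forall v, (sigma v /\ dot u v = 0) <->
              (exists2 c : R, 0 <= c & v = c *: lattice_vec R n).

Definition simplicial (R : realType) (d : nat) (sigma : cone R d) : Prop :=
  exists2 rho : 'I_d -> 'rV[int]_d,
    (forall i, ray_generator sigma (rho i)) &
    forall v, sigma v <-> cone_hull rho v.

(* The Z-bases of N are the families of rows of the elements of GL_d(Z).      *)
Definition regular (R : realType) (d : nat) (sigma : cone R d) : Prop :=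
  exists2 B : 'M[int]_d, B \in unitmx &
    forall n, ray_generator sigma n -> exists i, n = row i B.

(* The monoid sigma_M, the intersection of the dual cone with M.              *)
Record dual_monoid (R : realType) (d : nat) (sigma : cone R d) := DualMonoid {
  dm_val :> 'rV[int]_d;
  dm_valP : `[< dual_cone sigma (lattice_vec R dm_val) >]
}.

Section DualMonoid.
Context (R : realType) (d : nat) (sigma : cone R d).
Local Notation S := (dual_monoid sigma).

HB.instance Definition _ := [isSub for @dm_val R d sigma].
HB.instance Definition _ := [Choice of dual_monoid sigma by <:].

Lemma lattice_vecD (m n : 'rV[int]_d) :
  lattice_vec R (m + n) = lattice_vec R m + lattice_vec R n.
Proof. exact: map_mxD. Qed.

Lemma dotDl (u v w : 'rV[R]_d) : dot (u + v) w = dot u w + dot v w.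
Proof.
rewrite /dot -big_split; apply: eq_bigr => i _ /=.
by rewrite mxE mulrDl.
Qed.

Lemma dm_one_subproof : `[< dual_cone sigma (lattice_vec R 0) >].
Proof.
apply/asboolP => v _; rewrite /dot big1 // => i _.
by rewrite !mxE mul0r.
Qed.

Lemma dm_mul_subproof (x y : S) :
  `[< dual_cone sigma (lattice_vec R (dm_val x + dm_val y)) >].
Proof.
case: x y => [x /= /asboolP hx] [y /= /asboolP hy].
apply/asboolP => v sv; rewrite lattice_vecD dotDl.
by rewrite addr_ge0 ?hx ?hy.
Qed.

Definition dm_one : S := DualMonoid dm_one_subproof.
Definition dm_mul (x y : S) : S := DualMonoid (dm_mul_subproof x y).

Lemma dm_mulA : associative dm_mul.
Proof. by move=> x y z; apply/val_inj; rewrite /= addrA. Qed.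

Lemma dm_mul1m : left_id dm_one dm_mul.
Proof. by move=> x; apply/val_inj; rewrite /= add0r. Qed.

Lemma dm_mulm1 : right_id dm_one dm_mul.
Proof. by move=> x; apply/val_inj; rewrite /= addr0. Qed.

Lemma dm_mulC : commutative dm_mul.
Proof. by move=> x y; apply/val_inj; rewrite /= addrC. Qed.

Lemma dm_mul_eq1 (x y : S) : dm_mul x y = dm_one -> x = dm_one.
Proof.
move=> /(congr1 (@dm_val R d sigma)) /= xy0; apply/val_inj => /=.
have [B Bfree Bsigma] := cone_full_dimensional sigma.
have dot0 i : dot (lattice_vec R x) (row i B) = 0.
  have /asboolP/(_ _ (Bsigma i)) hx := dm_valP x.
  have /asboolP/(_ _ (Bsigma i)) hy := dm_valP y.
  have hxy : dot (lattice_vec R x) (row i B) + dot (lattice_vec R y) (row i B) = 0.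
    rewrite -dotDl -lattice_vecD xy0 /dot big1 // => j _.
    by rewrite !mxE mul0r.
  by apply/eqP; rewrite eq_le hx andbT -hxy lerDl.
have x0 : B *m (lattice_vec R x)^T = 0.
  apply/matrixP => i j; rewrite !mxE -[RHS](dot0 i) /dot.
  by apply: eq_bigr => k _; rewrite !mxE !ord1 mulrC.
have Bunit : B \in unitmx by rewrite -row_free_unit.
have /matrixP x0' : (lattice_vec R x)^T = 0.
  by rewrite -(mulKmx Bunit (lattice_vec R x)^T) x0 mulmx0.
apply/matrixP => i j; rewrite ord1 mxE.
by have /eqP := x0' j 0; rewrite !mxE intr_eq0 => /eqP.
Qed.

Lemma dm_unitm (x y : S) : dm_mul x y = dm_one -> x = dm_one /\ y = dm_one.
Proof.
by move=> xy; split; [apply: dm_mul_eq1 xy | move: xy; rewrite dm_mulC; apply: dm_mul_eq1].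
Qed.

HB.instance Definition _ := Choice_isMonomialDef.Build (dual_monoid sigma)
  dm_mulA dm_mul1m dm_mulm1 dm_unitm.
HB.instance Definition _ :=
  MonomialDef_isConomialDef.Build (dual_monoid sigma) dm_mulC.

End DualMonoid.

Definition toric_ring (K : fieldType) (R : realType) (d : nat)
    (sigma : cone R d) : comNzRingType :=
  {malg K[dual_monoid sigma]}.

Definition monomial (K : fieldType) (R : realType) (d : nat)
    (sigma : cone R d) (c : K) (s : dual_monoid sigma) : toric_ring K sigma :=
  << c *g s >>.

(* M-graded modules: gr m is the homogeneous component of degree m. Since     *)
(* the scalars are the monomials of degree 0, gr_monomial also makes each     *)
(* component a K-subspace.                                                    *)
Record graded_module (K : fieldType) (R : realType) (d : nat)
    (sigma : cone R d) := GradedModule {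
  gm_sort :> lmodType (toric_ring K sigma);
  gr : 'rV[int]_d -> gm_sort -> Prop;
  gr0 : forall m, gr m 0;
  grD : forall m x y, gr m x -> gr m y -> gr m (x + y);
  gr_monomial : forall (c : K) (s : dual_monoid sigma) m x,
    gr m x -> gr (dm_val s + m) (monomial c s *: x);
  gr_spans : forall x, exists2 t : seq gm_sort,
    (forall y, y \in t -> exists m, gr m y) & x = \sum_(y <- t) y;
  gr_direct : forall (t : seq 'rV[int]_d) (x : 'rV[int]_d -> gm_sort),
    uniq t -> (forall m, gr m (x m)) -> \sum_(m <- t) x m = 0 ->
    forall m, m \in t -> x m = 0
}.

Section DirectSum.
Context (K : fieldType) (R : realType) (d : nat) (sigma : cone R d).
Variables E F : graded_module K sigma.

Definition gsum_gr (m : 'rV[int]_d) (z : (E * F)%type) : Prop :=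
  gr m z.1 /\ gr m z.2.

Lemma gsum_gr0 m : gsum_gr m 0.
Proof. by split; apply: gr0. Qed.

Lemma gsum_grD m x y : gsum_gr m x -> gsum_gr m y -> gsum_gr m (x + y).
Proof. by move=> [x1 x2] [y1 y2]; split; apply: grD. Qed.

Lemma gsum_gr_monomial (c : K) (s : dual_monoid sigma) m x :
  gsum_gr m x -> gsum_gr (dm_val s + m) (monomial c s *: x).
Proof. by move=> [x1 x2]; split; apply: gr_monomial. Qed.

Lemma gsum_gr_spans x : exists2 t : seq (E * F)%type,
  (forall y, y \in t -> exists m, gsum_gr m y) & x = \sum_(y <- t) y.
Proof.
case: x => x1 x2; have [t1 h1 ->] := gr_spans x1; have [t2 h2 ->] := gr_spans x2.
exists ([seq (y, 0) | y <- t1] ++ [seq (0, y) | y <- t2]).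
  move=> y; rewrite mem_cat => /orP[] /mapP[z zt ->].
    by have [m mz] := h1 z zt; exists m; split=> //; apply: gr0.
  by have [m mz] := h2 z zt; exists m; split=> //; apply: gr0.
rewrite big_cat !big_map /=; apply/eqP; rewrite xpair_eqE /=.
rewrite !raddf_sum /=.
by rewrite [X in _ + X]big1 // addr0 [X in X + _ ]big1 // add0r !eqxx.
Qed.

Lemma gsum_gr_direct (t : seq 'rV[int]_d) (x : 'rV[int]_d -> (E * F)%type) :
  uniq t -> (forall m, gsum_gr m (x m)) -> \sum_(m <- t) x m = 0 ->
  forall m, m \in t -> x m = 0.
Proof.
move=> ut hx sx m mt; rewrite (surjective_pairing (x m)).
have := congr1 fst sx; rewrite raddf_sum => /= sx1.
have := congr1 snd sx; rewrite raddf_sum => /= sx2.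
rewrite (gr_direct ut (fun m => (hx m).1) sx1 mt).
by rewrite (gr_direct ut (fun m => (hx m).2) sx2 mt).
Qed.

Definition graded_sum : graded_module K sigma :=
  GradedModule gsum_gr0 gsum_grD gsum_gr_monomial gsum_gr_spans gsum_gr_direct.

End DirectSum.

Definition degree_preserving (K : fieldType) (R : realType) (d : nat)
    (sigma : cone R d) (E F : graded_module K sigma) (f : E -> F) : Prop :=
  forall m x, gr m x -> gr m (f x).

Definition graded_iso (K : fieldType) (R : realType) (d : nat)
    (sigma : cone R d) (E F : graded_module K sigma) : Prop :=
  exists (f : {linear E -> F}) (g : {linear F -> E}),
    [/\ degree_preserving f, degree_preserving g, cancel f g & cancel g f].

Definition zero_module (A : nzRingType) (E : lmodType A) : Prop :=
  forall x : E, x = 0.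

Definition indecomposable (K : fieldType) (R : realType) (d : nat)
    (sigma : cone R d) (E : graded_module K sigma) : Prop :=
  ~ zero_module E /\
  forall F G : graded_module K sigma,
    graded_iso E (graded_sum F G) -> zero_module F \/ zero_module G.

Section Modules.
Context (A : comNzRingType).

Definition finitely_generated (E : lmodType A) : Prop :=
  exists k (g : 'I_k -> E), forall x, exists a : 'I_k -> A,
    x = \sum_i a i *: g i.

Definition lin_indep (E : lmodType A) (k : nat) (g : 'I_k -> E) : Prop :=
  forall a : 'I_k -> A, \sum_i a i *: g i = 0 -> forall i, a i = 0.

(* Over an integral domain: the largest size of a linearly independent family *)
Definition has_rank (E : lmodType A) (r : nat) : Prop :=
  (exists g : 'I_r -> E, lin_indep g) /\
  ~ (exists g : 'I_r.+1 -> E, lin_indep g).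

Definition injective_module (J : lmodType A) : Prop :=
  forall (X Y : lmodType A) (i : {linear X -> Y}) (f : {linear X -> J}),
    injective i -> exists g : {linear Y -> J}, forall x, g (i x) = f x.

Record injective_resolution (E : lmodType A) := InjectiveResolution {
  ires :> nat -> lmodType A;
  ires_aug : {linear E -> ires 0};
  ires_diff : forall n, {linear ires n -> ires n.+1};
  ires_injective : forall n, injective_module (ires n);
  ires_exact_aug : injective ires_aug;
  ires_exact0 : forall x, ires_diff 0 x = 0 <-> exists y, x = ires_aug y;
  ires_exactS : forall n x,
    ires_diff n.+1 x = 0 <-> exists y, x = ires_diff n y
}.

Definition ideal_gen (S : A -> Prop) (a : A) : Prop :=
  exists k (c g : 'I_k -> A), (forall i, S (g i)) /\ a = \sum_i c i * g i.

(* Gamma_I(E): the elements killed by a power of the ideal I.                 *)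
Definition torsion (I : A -> Prop) (E : lmodType A) (x : E) : Prop :=
  exists n, forall a : 'I_n -> A, (forall i, I (a i)) -> (\prod_i a i) *: x = 0.

(* z is in the image of Gamma_I(J^(i-1)) -> Gamma_I(J^i), where J^(-1) = 0.   *)
Definition torsion_boundary (I : A -> Prop) (E : lmodType A)
    (J : injective_resolution E) (i : nat) : J i -> Prop :=
  match i with
  | 0 => fun z => z = 0
  | j.+1 => fun z => exists2 y : J j, torsion I y & z = ires_diff J j y
  end.

(* H^i_I(E) = 0, where H^i_I is the i-th right derived functor of Gamma_I.    *)
(* All injective resolutions give the same answer.                            *)
Definition local_cohomology_vanishes (I : A -> Prop) (E : lmodType A)
    (i : nat) : Prop :=
  forall (J : injective_resolution E) (z : J i),
    torsion I z -> ires_diff J i z = 0 -> torsion_boundary I z.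

End Modules.

(* The ideal of the torus fixed point.                                        *)
Definition fixed_point_ideal (K : fieldType) (R : realType) (d : nat)
    (sigma : cone R d) : toric_ring K sigma -> Prop :=
  ideal_gen (fun a => exists2 s : dual_monoid sigma,
    dm_val s != 0 & a = monomial 1 s).

Definition maximal_cohen_macaulay (K : fieldType) (R : realType) (d : nat)
    (sigma : cone R d) (E : graded_module K sigma) : Prop :=
  [/\ ~ zero_module E, finitely_generated E &
      forall i, (i < d)%N ->
        local_cohomology_vanishes (@fixed_point_ideal K R d sigma) E i].

(* Main.v *)
Require Import Defs.
From HB Require Import structures.
From mathcomp Require Import all_boot all_order all_algebra.
From mathcomp Require Import boolp reals.
From mathcomp Require Import finmap.
From mathcomp.multinomials Require Import monalg.
From mathcomp Require Import zify.

Set Implicit Arguments.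
Unset Strict Implicit.
Unset Printing Implicit Defensive.

Import Order.TTheory GRing.Theory Num.Theory.
Local Open Scope ring_scope.

(** Let rho_0, ..., rho_n be the ray generators of sigma, so that d = n + 1.
The map sending m to the vector of the pairings of m with the rho_k embeds M
in Z^d, with finite index since sigma is simplicial and with a proper image
since sigma is not regular ([nonregular_coordinates]); fix a nonnegative vector
b outside the image.  Let V be the quotient of K^d by its diagonal, of dimension
d - 1, and let e_k be the images of the basis vectors: their sum is zero and
any d - 1 of them form a basis.  The module E has the following component in
degree s: all of V if every coordinate of s exceeds that of b, the line K e_k
if only the k-th coordinate does not and equals b_k, and zero in the other
degrees.  Normalizing the coordinate 0 of a class in V to be zero makes E a
submodule of the free module A^d over the toric ring A ([line_mem]).

E is indecomposable since a degree-preserving endomorphism of E acts on V and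
preserves each line K e_k, which is a component of E in a suitable degree; as
the only relation between the e_k involves all of them, it is a scalar
([line_endomorphism]).  The rank is at most d - 1 because A^d has no
independent family of d vectors with first coordinate zero
([zero_column_not_injective]).

For the Cohen-Macaulay property, take N > 0 and m_0, ..., m_n in sigma_M such
that m_i has coordinates N in position i and 0 elsewhere.  A degree cannot be
congruent to b modulo N in all its coordinates, since b would then be in the
image of M.  This gives each degree s a coordinate k0 s not congruent to that
of b, depending on s modulo N only, and in degree s the component of E is
spanned by some of the vectors e_k, k != k0 s, of a basis of V.  In the
coordinates of these bases ([phi]) the monomials u_i of exponents q m_i act as
shifts, and it is seen on supports that u_0, ..., u_n is a regular sequence
on E ([regular_line]), as on A ([regular_toric]).

Let J be an injective resolution of E and J_t the subcomplex of the elements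
killed by u_0, ..., u_(t-1).  Regularity on A and injectivity make u_t
surjective on each J_t^i, with kernel J_(t+1)^i, and regularity on E then
shows by induction on t that the cohomology of J_t is concentrated in degree
t, where it is E / (u_0, ..., u_(t-1)) E ([killed_cohomology]).  For t = d
and q growing, the J_d exhaust the torsion of J, which gives the vanishing of
H^i for i < d. *)

(** * Linear algebra over commutative rings *)

(** A polynomial of least degree annihilating B has constant coefficient zero, as
the zero column shows; when B is injective it can thus be divided by the
variable. *)
Lemma zero_column_not_injective (A : comNzRingType) (n : nat)
    (B : 'M[A]_n.+1) :
  (forall i, B i 0 = 0) -> (forall x : 'rV[A]_n.+1, x *m B = 0 -> x = 0) ->
  False.
Proof.
move=> B0 Binj.
have Binj_mx (X : 'M[A]_n.+1) : X * B = 0 -> X = 0.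
  move=> XB; apply/row_matrixP => i; rewrite row0; apply: Binj.
  by rewrite -row_mul [_ *m _]XB row0.
suff nz q : q \is monic -> horner_mx B q != 0.
  by have /eqP := nz _ (char_poly_monic B); rewrite Cayley_Hamilton.
elim/poly_ind: q => [|q c IH].
  by rewrite monicE lead_coef0 eq_sym oner_eq0.
move=> mon; apply/eqP => qB0.
have qBE : horner_mx B q * B + c%:M = 0.
  by rewrite -qB0 rmorphD rmorphM /= horner_mx_X horner_mx_C.
have c0 : c = 0.
  have /matrixP/(_ 0 0) := qBE; rewrite !mxE eqxx mulr1n big1 ?add0r // => i _.
  by rewrite B0 mulr0.
move: mon qBE; rewrite c0 addr0 monicMr ?monicX // raddf0 addr0 => /IH/eqP nz.
by move/Binj_mx.
Qed.

(** An endomorphism with the same eigenvalue on a family that generates a x acts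
on x by this eigenvalue, up to a. *)
Lemma common_eigenvalue (A : comNzRingType) (E : lmodType A) (I : finType)
    (f : {linear E -> E}) (T : I -> E) (y : I -> A) (a h : A) (x : E) :
  (forall j, f (T j) = h *: T j) -> a *: x = \sum_j y j *: T j ->
  a *: f x = a *: (h *: x).
Proof.
move=> fT xT; have -> : a *: (h *: x) = h *: (a *: x).
  by rewrite !scalerA [a * h]mulrC.
rewrite -linearZZ xT linear_sum scaler_sumr; apply: eq_bigr => j _.
by rewrite linearZZ fT !scalerA [h * _]mulrC.
Qed.

(** For mutually inverse f and g this is the projection of E to its summand F. *)
Lemma corner_linear (A : nzRingType) (E F G : lmodType A)
    (f : {linear E -> (F * G)%type}) (g : {linear (F * G)%type -> E}) :
  linear (fun x => g ((f x).1, 0)).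
Proof.
move=> a x y; rewrite /= -linearZZ -[RHS]linearD; congr (g _).
by rewrite linearD linearZZ; congr pair; rewrite /= scaler0 addr0.
Qed.

Lemma scale_left_inverse (A : nzRingType) (E : lmodType A) (a a' : A) (x : E) :
  a' * a = 1 -> a *: x = 0 -> x = 0.
Proof. by move=> a'a ax; rewrite -[x]scale1r -a'a -scalerA ax scaler0. Qed.

(** * Submodules *)

Section Submodule.
Context (A : comNzRingType) (U : lmodType A).

Record submodule := Submodule {
  submodule_mem : U -> Prop;
  submodule0 : submodule_mem 0;
  submoduleD : forall x y, submodule_mem x -> submodule_mem y ->
    submodule_mem (x + y);
  submoduleZ : forall a x, submodule_mem x -> submodule_mem (a *: x)
}.

Variable W : submodule.

Definition submodule_pred : {pred U} := fun x => `[< submodule_mem W x >].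

Lemma submodule_pred_closed : submod_closed submodule_pred.
Proof.
split; first exact/asboolP/submodule0.
move=> a x y /asboolP Wx /asboolP Wy; apply/asboolP.
by apply: submoduleD => //; apply: submoduleZ.
Qed.

Record submodule_sort := SubmoduleSort {
  submodule_val :> U;
  submodule_valP : submodule_pred submodule_val
}.

HB.instance Definition _ := [isSub for submodule_val].
HB.instance Definition _ := [Choice of submodule_sort by <:].
HB.instance Definition _ := GRing.SubChoice_isSubLmodule.Build A U
  submodule_pred submodule_sort submodule_pred_closed.

Lemma submoduleP (x : submodule_sort) : submodule_mem W (submodule_val x).
Proof. exact/asboolP/submodule_valP. Qed.

Definition in_submodule (x : U) (Wx : submodule_mem W x) : submodule_sort :=
  SubmoduleSort (introT (asboolP _) Wx).

Lemma submodule_val_inj : injective (fun x : submodule_sort => submodule_val x).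
Proof. exact: val_inj. Qed.

Lemma submodule_val0 : submodule_val 0 = 0.
Proof. exact: (raddf0 (val : submodule_sort -> U)). Qed.

Lemma submodule_valD (x y : submodule_sort) :
  submodule_val (x + y) = submodule_val x + submodule_val y.
Proof. exact: (raddfD (val : submodule_sort -> U)). Qed.

Lemma submodule_val_sum (T : Type) (r : seq T) (F : T -> submodule_sort) :
  submodule_val (\sum_(i <- r) F i) = \sum_(i <- r) submodule_val (F i).
Proof. exact: (big_morph _ submodule_valD submodule_val0). Qed.

Lemma submodule_valZ a (x : submodule_sort) :
  submodule_val (a *: x) = a *: submodule_val x.
Proof. by have := linearZ_LR (val : submodule_sort -> U) a x. Qed.
End Submodule.
Arguments submodule_val : simpl never.

(** * Regular sequences and injective resolutions *)

Section RegularSequences.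
Context (A : comNzRingType) (u : nat -> A).

(** The submodule (u_0, ..., u_(t-1)) X. *)
Definition span_seq (X : lmodType A) (t : nat) (x : X) : Prop :=
  exists f : nat -> X, x = \sum_(i < t) u i *: f i.

(** Only the nonzerodivisor half of regularity: the quotient of X by the ideal of
the sequence may be zero. *)
Definition regular_on (X : lmodType A) (n : nat) : Prop :=
  forall t (x : X), (t < n)%N -> span_seq t (u t *: x) -> span_seq t x.

Definition killed (X : lmodType A) (t : nat) (x : X) : Prop :=
  forall i, (i < t)%N -> u i *: x = 0.

Section Span.
Variable X : lmodType A.
Implicit Types x y : X.

Lemma span_seq0 t : span_seq t (0 : X).
Proof. by exists (fun=> 0); rewrite big1 // => i _; rewrite scaler0. Qed.

Lemma span_seqD t x y : span_seq t x -> span_seq t y -> span_seq t (x + y).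
Proof.
move=> [f ->] [g ->]; exists (fun i => f i + g i).
by rewrite -big_split; apply: eq_bigr => i _; rewrite scalerDr.
Qed.

Lemma span_seqZ t a x : span_seq t x -> span_seq t (a *: x).
Proof.
move=> [f ->]; exists (fun i => a *: f i).
by rewrite scaler_sumr; apply: eq_bigr => i _; rewrite !scalerA mulrC.
Qed.

Lemma span_seq_mem t i y : (i < t)%N -> span_seq t (u i *: y).
Proof.
move=> it; exists (fun j => if j == i then y else 0).
rewrite (bigD1 (Ordinal it)) //= eqxx big1 ?addr0 // => j.
by rewrite -val_eqE /= => /negbTE->; rewrite scaler0.
Qed.

Lemma span_seqS t x :
  span_seq t.+1 x <-> exists y, span_seq t (x - u t *: y).
Proof.
split=> [[f ->]|[y [f xf]]].
  by exists (f t), f; rewrite big_ord_recr addrK.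
exists (fun i => if i == t then y else f i).
rewrite big_ord_recr /= eqxx -(subrK (u t *: y) x) xf; congr (_ + _).
by apply: eq_bigr => i _; rewrite ltn_eqF.
Qed.

Lemma killed_span t (a : A) x :
  killed t x -> span_seq t (a : A^o) -> a *: x = 0.
Proof.
move=> kx [f ->]; rewrite scaler_suml big1 // => i _.
by rewrite -[_ *: f i]mulrC -scalerA kx // scaler0.
Qed.

Lemma killed0 t : killed t (0 : X). Proof. by move=> i _; rewrite scaler0. Qed.

Lemma killedD t x y : killed t x -> killed t y -> killed t (x + y).
Proof. by move=> kx ky i it; rewrite scalerDr kx ?ky ?addr0. Qed.

Lemma killedZ t a x : killed t x -> killed t (a *: x).
Proof. by move=> kx i it; rewrite scalerA mulrC -scalerA kx // scaler0. Qed.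

Lemma killedB t x y : killed t x -> killed t y -> killed t (x - y).
Proof. by move=> kx ky i it; rewrite scalerBr kx ?ky ?subr0. Qed.

Lemma killedS t x : killed t.+1 x <-> killed t x /\ u t *: x = 0.
Proof.
split=> [kx|[kx ux] i]; first by split=> [i it|]; apply: kx => //; apply: ltnW.
by rewrite ltnS leq_eqVlt => /orP[/eqP->|/kx].
Qed.

Lemma killed_lin (Y : lmodType A) (f : {linear X -> Y}) t x :
  killed t x -> killed t (f x).
Proof. by move=> kx i it; rewrite -linearZ kx // linear0. Qed.
End Span.

Lemma span_seq_base t i : (i < t)%N -> span_seq t (u i : A^o).
Proof. by move=> it; rewrite -[u i]mulr1; apply: (@span_seq_mem A^o). Qed.

Lemma span_seq_mul t i (a : A) : (i < t)%N -> span_seq t (u i * a : A^o).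
Proof. exact: (@span_seq_mem A^o). Qed.

(** Sending a u_t + c to a z, for c in the ideal (u_0, ..., u_(t-1)), is well
defined on the ideal (u_0, ..., u_t) by regularity and extends to A by
injectivity; the image of 1 is the quotient of z by u_t. *)
Lemma killed_divisible (J : lmodType A) t n (z : J) :
  injective_module J -> regular_on A^o n -> (t < n)%N -> killed t z ->
  exists2 w : J, killed t w & u t *: w = z.
Proof.
move=> injJ regA tn kz.
pose I := @Submodule A A^o (@span_seq A^o t.+1) (@span_seq0 _ _)
  (@span_seqD _ _) (fun a x => @span_seqZ _ _ a x).
have quo (x : submodule_sort I) :
    {a : A^o | span_seq t (submodule_val x - u t *: a)}.
  by apply/cid; apply/span_seqS; apply: submoduleP x.
pose f (x : submodule_sort I) : J := (projT1 (quo x) : A) *: z.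
have fE (x : submodule_sort I) (a : A^o) :
    span_seq t (submodule_val x - u t *: a) -> f x = (a : A) *: z.
  move=> xa; apply/eqP; rewrite -subr_eq0 -scalerBl; apply/eqP.
  apply: (killed_span kz); apply: regA tn _.
  have /(span_seqZ (-1)) h := projT2 (quo x).
  have := span_seqD xa h; congr (span_seq _ _).
  by rewrite /f scaleN1r scalerBr opprB addrC addrA subrK.
have f_lin : linear f.
  move=> a x y.
  rewrite (fE _ (a *: projT1 (quo x) + projT1 (quo y))).
    by rewrite scalerDl scalerA.
  have := span_seqD (span_seqZ a (projT2 (quo x))) (projT2 (quo y)).
  congr (span_seq _ _).
  rewrite submodule_valD submodule_valZ scalerBr scalerDr !scalerA.
  by rewrite [a * u t]mulrC addrACA -opprD.
pose fL := GRing.isLinear.Build _ _ _ _ f f_lin.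
pose fl : {linear submodule_sort I -> J} := HB.pack f fL.
have [g gf] := injJ _ A^o (val : {linear submodule_sort I -> A^o}) fl val_inj.
have uI i (it : (i < t.+1)%N) : submodule_mem I (u i) := span_seq_base it.
have gu i (it : (i < t.+1)%N) : u i *: g 1 = f (in_submodule (uI i it)).
  rewrite -[RHS]gf /= -linearZ /=; congr (g _).
  by rewrite [LHS](mulr1 (u i)).
exists (g 1) => [i it|].
  rewrite (gu i (ltnW it)) (fE _ 0) ?scale0r // scaler0 subr0 /=.
  exact: span_seq_base.
rewrite (gu t (ltnSn t)) (fE _ 1) ?scale1r //=.
by rewrite [_ *: 1]mulr1 subrr; apply: span_seq0.
Qed.

Section Resolution.
Context (E : lmodType A) (J : injective_resolution E) (n : nat).
Hypotheses (regA : regular_on A^o n) (regE : regular_on E n).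

Let delta i : {linear J i -> J i.+1} := ires_diff J i.

Definition boundary (t i : nat) : J i -> Prop :=
  match i with
  | 0 => fun z => z = 0
  | j.+1 => fun z => exists2 y : J j, killed t y & z = ires_diff J j y
  end.

Lemma deltaK i (x : J i) : delta i.+1 (delta i x) = 0.
Proof. by apply/ires_exactS; exists x. Qed.

(** The graph, up to boundaries, of the iterated connecting homomorphism from
E = H^0(J_0) to H^t(J_t), where J_t is the subcomplex killed by the first t
elements; each step is the connecting map of the short exact sequence
0 -> J_(t+1) -> J_t -> J_t -> 0 given by the multiplication by u_t.  The
relation at t + 1 is stable under adding boundaries of J_(t+1), as w can be
changed by elements of J_(t+1). *)
Fixpoint connecting (t : nat) : E -> J t -> Prop :=
  match t with
  | 0 => fun e z => z = ires_aug J e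
  | s.+1 => fun e z => exists w : J s,
      [/\ killed s w, connecting e (u s *: w) & z = ires_diff J s w]
  end.

Lemma connectingD t e e' (z z' : J t) :
  connecting e z -> connecting e' z' -> connecting (e + e') (z + z').
Proof.
elim: t e e' z z' => [|t IH] e e' z z' /=.
  by move=> -> ->; rewrite linearD.
move=> [w [kw ew ->]] [w' [kw' ew' ->]]; exists (w + w').
by split; [apply: killedD | rewrite scalerDr; apply: IH | rewrite linearD].
Qed.

Lemma connectingZ t a e (z : J t) :
  connecting e z -> connecting (a *: e) (a *: z).
Proof.
elim: t e z => [|t IH] e z /=; first by move=> ->; rewrite linearZ.
move=> [w [kw ew ->]]; exists (a *: w).
split; [exact: killedZ | | by rewrite linearZ].
by rewrite scalerA mulrC -scalerA; apply: IH.
Qed.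

Lemma connectingB t e e' (z z' : J t) :
  connecting e z -> connecting e' z' -> connecting (e - e') (z - z').
Proof.
move=> ez ez'; rewrite -(scaleN1r e') -(scaleN1r z').
by apply: connectingD => //; apply: connectingZ.
Qed.

Lemma connecting_cocycle t e (z : J t) :
  connecting e z -> killed t z /\ delta t z = 0.
Proof.
elim: t e z => [|t IH] e z /=.
  by move=> ->; split=> //; apply/ires_exact0; exists e.
move=> [w [kw ew ->]]; split; last exact: deltaK.
apply/killedS; split; first exact: killed_lin.
by rewrite -linearZ; apply: (IH _ _ ew).2.
Qed.

Lemma connecting_total t e : (t <= n)%N -> exists z : J t, connecting e z.
Proof.
elim: t => [|t IH] tn; first by exists (ires_aug J e).
have [z ez] := IH (ltnW tn).
have [w kw wz] := killed_divisible (@ires_injective _ _ J t) regA tn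
  (connecting_cocycle ez).1.
by exists (delta t w), w; split; rewrite ?wz.
Qed.

(** If u_t y bounds in J_t, then y can be changed by a cocycle into an element
killed by u_t as well. *)
Lemma boundary_lift t i (y : J i) : (t < n)%N -> killed t y ->
  boundary t (u t *: y) ->
  exists2 y' : J i, killed t.+1 y' & delta i y' = delta i y.
Proof.
move=> tn ky; case: i y ky => [|i] y ky /=.
  by move=> uy; exists y => //; apply/killedS.
move=> [y1 ky1 uy].
have [y2 ky2 uy2] := killed_divisible (@ires_injective _ _ J i) regA tn ky1.
exists (y - delta i y2); last by rewrite linearB deltaK subr0.
apply/killedS; split; first by apply: killedB => //; apply: killed_lin.
by rewrite scalerBr uy -linearZ uy2 subrr.
Qed.

(** The long exact sequence of u_t, written out on elements: H^i(J_t) vanishes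
for i != t, and the connecting relation identifies H^t(J_t) with the quotient
of E by (u_0, ..., u_(t-1)) E.  The last three clauses are surjectivity,
injectivity and well-definedness of this identification. *)
Lemma killed_cohomology t : (t <= n)%N ->
  [/\ forall i (z : J i), i <> t -> killed t z -> delta i z = 0 -> boundary t z,
      forall z : J t, killed t z -> delta t z = 0 -> exists e, connecting e z,
      forall e (z : J t), connecting e z -> boundary t z -> span_seq t e &
      forall e (z : J t), connecting e z -> span_seq t e -> boundary t z].
Proof.
elim: t => [_|t IH tn].
  split=> [[//|i] z _ _ /ires_exactS[y ->]|z _ /ires_exact0[e ->]|e z /=|e z /=].
  - by exists y.
  - by exists e.
  - move=> -> aug0; have -> : e = 0; last exact: span_seq0.
    by apply: (@ires_exact_aug _ _ J); rewrite aug0 linear0.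
  - by move=> -> [f ->]; rewrite big_ord0 linear0.
have {IH} [exact_off onto bd_span span_bd] := IH (ltnW tn).
have exactS i (z : J i) : killed t.+1 z -> delta i z = 0 -> i <> t.+1 ->
    boundary t.+1 z.
  move=> /killedS[kz uz] dz it.
  have bz : boundary t z.
    (* H^t(J_(t+1)) embeds in the kernel of u_t on H^t(J_t) = E / (u) E,
       which is zero as the sequence is regular on E. *)
    have [tE|tE] := eqVneq i t; last by apply: exact_off => //; apply/eqP.
    case: _ / (esym tE) in z it kz uz dz *.
    have [e ez] := onto z kz dz; apply: (span_bd e) => //.
    apply: regE => //; apply: (bd_span _ (u t *: z)); first exact: connectingZ.
    rewrite uz; case: (t) => [//|s].
    by exists 0; [exact: killed0 | rewrite linear0].
  case: i z kz uz dz it bz => [//|i] z kz uz dz it [y ky zy].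
  have [|||y' ky' yy'] := @boundary_lift t i y => //.
    apply: exact_off => [ti||]; [by rewrite ti in it|exact: killedZ|].
    by rewrite linearZ /= /delta -zy uz.
  by exists y' => //; rewrite zy.
split=> [i z it kz dz|z /killedS[kz uz] dz|e z|e z].
- exact: exactS.
- have [|y ky zy] := exact_off t.+1 z _ kz dz; first by move/esym/n_Sn.
  have [||e ez] := onto (u t *: y); first exact: killedZ.
    by rewrite linearZ /= /delta -zy uz.
  by exists e, y.
- move=> [w [kw ew ->]] [y /killedS[ky uy] wy].
  have [||e' ewy] := onto (w - y); first exact: killedB.
    by rewrite linearB /= /delta wy subrr.
  apply/span_seqS; exists e'.
  apply: (bd_span _ (u t *: w - u t *: (w - y))).
    by apply: connectingB => //; apply: connectingZ.
  rewrite -scalerBr opprB addrC subrK uy.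
  by case: (t) => [//|s]; exists 0; [exact: killed0|rewrite linear0].
move=> [w [kw ew ->]] /span_seqS[f ef].
have [zf fzf] := connecting_total f (ltnW tn).
have [kzf dzf] := connecting_cocycle fzf.
have [|||y ky yE] := @boundary_lift t t (w - zf) => //; first exact: killedB.
  apply: (span_bd (e - u t *: f)) => //.
  by rewrite scalerBr; apply: connectingB => //; apply: connectingZ.
by exists y => //; rewrite -[RHS]/(delta t y) yE linearB dzf subr0.
Qed.

End Resolution.
End RegularSequences.

(** * Simplicial cones in coordinates *)

Section Cones.
Context (R : realType) (d : nat).
Implicit Types (m n : 'rV[int]_d) (v w : 'rV[R]_d).

Lemma dot_lattice m n :
  dot (lattice_vec R m) (lattice_vec R n) = (\sum_i m 0 i * n 0 i)%:~R.
Proof. by rewrite rmorph_sum; apply: eq_bigr => i _; rewrite !mxE rmorphM. Qed.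

Lemma dotZr (u v : 'rV[R]_d) (c : R) : dot u (c *: v) = c * dot u v.
Proof.
by rewrite /dot mulr_sumr; apply: eq_bigr => i _; rewrite mxE mulrCA.
Qed.

Lemma dot_sumr (I : finType) (u : 'rV[R]_d) (c : I -> R) (v : I -> 'rV[R]_d) :
  dot u (\sum_i c i *: v i) = \sum_i c i * dot u (v i).
Proof.
under [RHS]eq_bigr do rewrite -dotZr.
rewrite /dot exchange_big; apply: eq_bigr => j _ /=.
by rewrite summxE mulr_sumr.
Qed.

(** Iterated Bezout identity over the entries of n. *)
Lemma gcd_combination n : exists (g : int) m,
  \sum_i m 0 i * n 0 i = g /\ forall i, (g %| n ord0 i)%Z.
Proof.
suff [g [m [mg gn]]] : exists (g : int) m, \sum_i m 0 i * n 0 i = g /\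
    forall i, i \in enum 'I_d -> (g %| n ord0 i)%Z.
  by exists g, m; split=> // i; apply: gn; rewrite mem_enum.
elim: (enum 'I_d) => [|j s [g [m [mg gn]]]].
  by exists 0, 0; split=> //; rewrite big1 // => i _; rewrite mxE mul0r.
have [a [b ab]] := Bezoutz (n 0 j) g.
exists (gcdz (n 0 j) g), (a *: delta_mx 0 j + b *: m); split.
  rewrite -ab -mg mulr_sumr.
  under eq_bigr => i _ do rewrite 2!mxE mulrDl.
  rewrite big_split /= (bigD1 j) //= big1 => [|i /negbTE ij].
    rewrite !mxE !eqxx mulr1 addr0; congr (_ + _).
    by apply: eq_bigr => i _; rewrite !mxE mulrA.
  by rewrite !mxE ij andbF mulr0 mul0r.
move=> i; rewrite inE => /orP[/eqP->|/gn]; first exact: dvdz_gcdl.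
exact/dvdz_trans/dvdz_gcdr.
Qed.

Lemma primitive_bezout n : primitive n -> exists m, \sum_i m 0 i * n 0 i = 1.
Proof.
move=> prim_n; have [g [m [mg gn]]] := gcd_combination n.
have /prim_n gU : n = g *: \row_i (n ord0 i %/ g)%Z.
  by apply/rowP => i; rewrite !mxE mulrC divzK.
exists (g *: m); under eq_bigr => i _ do rewrite mxE -mulrA.
rewrite -mulr_sumr mg; case/orP: gU => /eqP-> //.
Qed.

(** A Bezout vector of n shows that the real ratio of n' to n is an integer; it
divides the primitive vector n'. *)
Lemma primitive_eq n n' (c : R) : primitive n -> primitive n' -> 0 <= c ->
  lattice_vec R n' = c *: lattice_vec R n -> n' = n.
Proof.
move=> prim_n prim_n' c0 n'n; have [m mn] := primitive_bezout prim_n.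
pose k := \sum_i m 0 i * n' 0 i.
have ck : c = k%:~R.
  have := dot_lattice m n'; rewrite -/k => <-.
  by rewrite n'n dotZr dot_lattice mn mulr1.
have n'k : n' = k *: n.
  apply/rowP => i; have /rowP/(_ i) := n'n.
  by rewrite !mxE ck -intrM => /intr_inj.
have := prim_n' _ _ n'k; rewrite n'k; case/orP=> /eqP kE.
  by rewrite kE scale1r.
by move: c0; rewrite ck kE ler0z.
Qed.

Lemma primitive_neq0 n : primitive n -> n != 0.
Proof. by move=> /(_ 0 0); rewrite scaler0 => h; apply/eqP => /h. Qed.

Section Simplicial.
Variables (sigma : cone R d) (rho : 'I_d -> 'rV[int]_d).
Hypotheses (rho_ray : forall i, ray_generator sigma (rho i))
  (rhoP : forall v, sigma v <-> cone_hull rho v).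

Lemma sigma_rho i : sigma (lattice_vec R (rho i)).
Proof.
apply/rhoP; exists (fun j => (j == i)%:R) => [j|]; first exact: ler0n.
rewrite (bigD1 i) //= eqxx scale1r big1 ?addr0 // => j /negbTE->.
by rewrite scale0r.
Qed.

Lemma dual_cone_rho m :
  dual_cone sigma (lattice_vec R m) <->
  forall k, 0 <= \sum_i m 0 i * rho k 0 i.
Proof.
split=> [sm k|m_ge0 v /rhoP[c c_ge0 ->]].
  by have := sm _ (sigma_rho k); rewrite dot_lattice ler0z.
rewrite dot_sumr; apply: sumr_ge0 => i _.
by rewrite dot_lattice mulr_ge0 // ler0z.
Qed.

(** The cone contains a basis of R^d, whose matrix factors through that of the
generators. *)
Lemma det_rho_neq0 : \det (\matrix_i rho i) != 0.
Proof.
have [B Bfree Bsigma] := cone_full_dimensional sigma.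
have cB i : {c : 'rV[R]_d | row i B = c *m map_mx intr (\matrix_i rho i)}.
  apply/cid; have /rhoP[c _ cE] := Bsigma i; exists (\row_j c j).
  rewrite cE; apply/rowP => j; rewrite summxE !mxE; apply: eq_bigr => k _.
  by rewrite !mxE.
have BE : B = (\matrix_i projT1 (cB i)) *m map_mx intr (\matrix_i rho i).
  by apply/row_matrixP => i; rewrite row_mul rowK; exact: projT2 (cB i).
move: Bfree; rewrite row_free_unit unitmxE BE det_mulmx unitfE mulf_eq0 negb_or.
by case/andP=> _; rewrite det_map_mx intr_eq0.
Qed.

(** A linear form cutting out the ray vanishes on every rho i with a positive
coefficient in an expression of n; such a rho i then lies on the ray. *)
Lemma ray_generator_rho n : ray_generator sigma n -> exists i, n = rho i.
Proof.
move=> [prim_n [u u_dual uP]].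
have [] : sigma (lattice_vec R n) /\ dot u (lattice_vec R n) = 0.
  by apply/uP; exists 1; rewrite ?scale1r.
move=> /rhoP[c c_ge0 nE] un0.
have cu_ge0 i : 0 <= c i * dot u (lattice_vec R (rho i)).
  by apply: mulr_ge0 => //; apply: u_dual; apply: sigma_rho.
have /existsP[i ci] : [exists i, c i != 0].
  apply: contraNT (primitive_neq0 prim_n) => /existsPn c0.
  apply/eqP/rowP => j; apply: (@intr_inj R).
  have /rowP/(_ j) := nE; rewrite !mxE => ->; rewrite summxE big1 // => i _.
  by have := c0 i; rewrite negbK => /eqP->; rewrite mxE mul0r.
exists i; apply/esym; have [b b_ge0] : exists2 b : R, 0 <= b &
    lattice_vec R (rho i) = b *: lattice_vec R n.
  apply/uP; split; first exact: sigma_rho.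
  move: un0; rewrite nE dot_sumr => /psumr_eq0P-/(_ (fun i _ => cu_ge0 i) i isT).
  by move=> /eqP; rewrite mulf_eq0 (negbTE ci) => /eqP.
by apply: primitive_eq => //; have [] := rho_ray i.
Qed.
End Simplicial.

(** The columns of Q are the ray generators.  If every basis vector were in the
image of M, then Q would be invertible over the integers and its columns would
be a basis of N; so some basis vector can be taken for b. *)
Lemma nonregular_coordinates (sigma : cone R d) :
  simplicial sigma -> ~ regular sigma ->
  exists Q : 'M[int]_d,
  [/\ forall m, dual_cone sigma (lattice_vec R m) <->
        forall k, 0 <= (m *m Q) 0 k,
      \det Q != 0,
      forall k, exists m, (m *m Q) 0 k = 1 &
      exists b : 'rV[int]_d, (forall k, 0 <= b 0 k) /\ forall m, m *m Q != b].
Proof.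
move=> [rho rho_ray rhoP] nreg; exists (\matrix_i rho i)^T.
have QE m k : (m *m (\matrix_i rho i)^T) 0 k = \sum_i m 0 i * rho k 0 i.
  by rewrite mxE; apply: eq_bigr => i _; rewrite !mxE.
split=> [m||k|].
- have -> : (forall k, 0 <= (m *m (\matrix_i rho i)^T) 0 k) <->
      (forall k, 0 <= \sum_i m 0 i * rho k 0 i).
    by split=> h k; have := h k; rewrite QE.
  exact: dual_cone_rho.
- by rewrite det_tr (det_rho_neq0 rhoP).
- have [m mk] := primitive_bezout (rho_ray k).1.
  by exists m; rewrite QE.
apply: contrapT => nb; case: nreg; exists (\matrix_i rho i) => [|n]; last first.
  by move=> /(ray_generator_rho rho_ray rhoP) [i ->]; exists i; rewrite rowK.
have dP i : {m : 'rV[int]_d | m *m (\matrix_i rho i)^T = delta_mx 0 i}.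
  apply: cid; apply: contrapT => ndP; apply: nb.
  exists (delta_mx 0 i); split=> [k|m].
    by rewrite mxE ler0n.
  by apply/eqP => mE; apply: ndP; exists m.
rewrite -unitmx_tr.
have : (\matrix_i projT1 (dP i)) *m (\matrix_i rho i)^T = 1%:M.
  apply/row_matrixP => i; rewrite row_mul rowK row1; exact: projT2 (dP i).
by move/mulmx1_unit => [].
Qed.
End Cones.

(** * Coefficients in the toric ring *)

Section Coefficients.
Context (K : fieldType) (R : realType) (d : nat) (sigma : cone R d).
Local Notation S := (dual_monoid sigma).
Local Notation A := (toric_ring K sigma).
Implicit Types (s t : S) (a : A) (c : K).

Definition coef s a : K := mcoeff s (a : {malg K[S]}).

Lemma coef_is_additive s : zmod_morphism (coef s).
Proof. exact: mcoeffB. Qed.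

HB.instance Definition _ s :=
  GRing.isZmodMorphism.Build A K (coef s) (coef_is_additive s).

Lemma coefP a a' : (forall s, coef s a = coef s a') -> a = a'.
Proof. by move=> aa'; apply/malgP => s; apply: aa'. Qed.

Lemma coef_monomial c s t : coef t (monomial c s) = c *+ (s == t).
Proof. exact: mcoeffU. Qed.

Lemma monomial0 s : monomial 0 s = 0 :> A.
Proof. exact: monalgU0. Qed.

Lemma monomial1 : monomial 1 (dm_one sigma) = 1 :> A.
Proof. by []. Qed.

Lemma monomialD c c' s :
  monomial (c + c') s = monomial c s + monomial c' s :> A.
Proof. exact: monalgUD. Qed.

Lemma monomialM c c' s t :
  monomial c s * monomial c' t = monomial (c * c') (dm_mul s t) :> A.
Proof. exact: fgmulUU. Qed.

Lemma monomial1M c c' s :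
  monomial c (dm_one sigma) * monomial c' s = monomial (c * c') s :> A.
Proof. by rewrite monomialM dm_mul1m. Qed.

Lemma monomialX s t :
  monomial 1 s * monomial 1 t = monomial 1 (dm_mul s t) :> A.
Proof. by rewrite monomialM mulr1. Qed.

Lemma dm_mulI s : injective (dm_mul s).
Proof. by move=> t t' /(congr1 val) /= /addrI/val_inj. Qed.

Lemma toric_sum a : exists r : seq S,
  a = \sum_(s <- r) monomial (coef s a) s.
Proof. by exists (finmap.enum_fset (msupp a)); apply: monalgE. Qed.

Lemma coef_support a : exists r : seq S, forall s, coef s a != 0 -> s \in r.
Proof.
exists (finmap.enum_fset (msupp a)) => s sa.
by rewrite -[_ \in _]/(s \in msupp a) -mcoeff_neq0.
Qed.

Lemma coef_monomialM c s t a :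
  coef (dm_mul s t) (monomial c s * a) = c * coef t a.
Proof.
have [r ->] := toric_sum a; rewrite mulr_sumr !raddf_sum mulr_sumr.
apply: eq_bigr => t' _ /=; rewrite monomialM !coef_monomial.
by rewrite (inj_eq (@dm_mulI s)) mulrnAr.
Qed.

Lemma coefM_neq0 s a a' : coef s (a * a') != 0 ->
  exists t t', [/\ coef t a != 0, coef t' a' != 0 & s = dm_mul t t'].
Proof.
move=> saa'; have : s \in msupp (a * a' : {malg K[S]}).
  by rewrite -mcoeff_neq0.
move=> /msuppM_le[t [t' [ta ta' ->]]].
by exists t, t'; split=> //; rewrite /coef mcoeff_neq0.
Qed.

Lemma coef_monomialM_neq0 c s t a : coef t (monomial c s * a) != 0 ->
  exists2 t', t = dm_mul s t' & coef t' a != 0.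
Proof.
move=> /coefM_neq0[s' [t' [ss' ta ->]]]; exists t' => //.
by move: ss'; rewrite coef_monomial; have [->|_] := eqVneq s s'; rewrite ?eqxx.
Qed.

Lemma monomial_cancel s a a' : monomial 1 s * a = monomial 1 s * a' -> a = a'.
Proof.
move=> saa'; apply: coefP => t.
by rewrite -[LHS]mul1r -[RHS]mul1r -!(coef_monomialM 1 s) saa'.
Qed.

Definition dm_pow s (q : nat) : S := iter q (dm_mul s) (dm_one sigma).

Lemma monomial_pow s q : monomial 1 (dm_pow s q) = monomial 1 s ^+ q :> A.
Proof.
by elim: q => [|q IH]; rewrite ?expr0 ?monomial1 // exprS -IH monomialM mulr1.
Qed.
End Coefficients.

(** * The module of the lines *)

(* The toric ring stays folded: products are handled through coef and
   monomialM. *)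
Opaque toric_ring.

Section LineModule.
Context (K : fieldType) (R : realType) (n : nat) (sigma : cone R n.+1).
Local Notation S := (dual_monoid sigma).
Local Notation A := (toric_ring K sigma).
Local Notation I := 'I_n.+1.
Context (Q : 'M[int]_n.+1) (b : I -> int) (N : int) (mm : I -> S).

(** The pairing of m with the k-th ray generator, the columns of Q being the ray
generators. *)
Definition crd (m : 'rV[int]_n.+1) (k : I) : int := (m *m Q) 0 k.
Definition pos (s : S) : I -> int := crd (dm_val s).

Hypotheses (dualQ : forall m, dual_cone sigma (lattice_vec R m) <->
                              forall k, 0 <= crd m k)
  (detQ : \det Q != 0)
  (N_gt0 : 0 < N)
  (mmP : forall j k, pos (mm j) k = N *+ (j == k))
  (b_ge0 : forall k, 0 <= b k)
  (bP : forall m, exists k, crd m k != b k)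
  (Qprim : forall k, exists m, crd m k = 1).

Lemma crdD m m' k : crd (m + m') k = crd m k + crd m' k.
Proof. by rewrite /crd mulmxDl mxE. Qed.

Lemma crdB m m' k : crd (m - m') k = crd m k - crd m' k.
Proof. by rewrite /crd mulmxBl !mxE. Qed.

Lemma crd_sum (T : Type) (r : seq T) (F : T -> 'rV[int]_n.+1) k :
  crd (\sum_(i <- r) F i) k = \sum_(i <- r) crd (F i) k.
Proof. by rewrite /crd mulmx_suml summxE. Qed.

Lemma crdZ c m k : crd (c *: m) k = c * crd m k.
Proof. by rewrite /crd -scalemxAl mxE. Qed.

Lemma crd_mm (q : I -> int) k : crd (\sum_j q j *: dm_val (mm j)) k = q k * N.
Proof.
rewrite crd_sum (bigD1 k) //= big1 => [|j /negbTE jk].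
  by rewrite addr0 crdZ -/(pos _ _) mmP eqxx.
by rewrite crdZ -/(pos _ _) mmP jk mulr0.
Qed.

Lemma crd_inj m m' : (forall k, crd m k = crd m' k) -> m = m'.
Proof.
move=> mm'; have : m *m Q *m \adj Q = m' *m Q *m \adj Q.
  by congr (_ *m _); apply/rowP.
rewrite -!mulmxA mul_mx_adj !mul_mx_scalar => /rowP mE; apply/rowP => k.
by have := mE k; rewrite !mxE => /(mulfI detQ).
Qed.

Lemma posM s t k : pos (dm_mul s t) k = pos s k + pos t k.
Proof. exact: crdD. Qed.

Lemma pos_pow s q k : pos (dm_pow s q) k = pos s k *+ q.
Proof.
elim: q => [|q IH]; last by rewrite posM IH mulrS.
by rewrite /pos /crd mul0mx mxE.
Qed.

Lemma pos_ge0 s k : 0 <= pos s k.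
Proof. by have /asboolP/dualQ := dm_valP s; apply. Qed.

Lemma pos_inj s t : (forall k, pos s k = pos t k) -> s = t.
Proof. by move=> st; apply/val_inj/crd_inj. Qed.

Lemma dm_of m : (forall k, 0 <= crd m k) -> exists s : S, dm_val s = m.
Proof. by move=> /dualQ/asboolP sm; exists (DualMonoid sm). Qed.

Lemma dm_div s t : (forall k, pos s k <= pos t k) -> exists r, t = dm_mul s r.
Proof.
move=> st; have [|r rE] := dm_of (m := dm_val t - dm_val s).
  by move=> k; rewrite crdB subr_ge0; apply: st.
by exists r; apply: val_inj; rewrite /= rE addrC subrK.
Qed.

(** The pick is extensional, so that k0 s depends only on the coordinates of s
modulo N. *)
Definition k0 (s : S) : I := odflt 0 [pick i | ~~ (N %| pos s i - b i)%Z].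

(** Otherwise subtracting multiples of the mm j from s would give an element of M
with coordinates b. *)
Lemma k0P s : ~~ (N %| pos s (k0 s) - b (k0 s))%Z.
Proof.
rewrite /k0; case: pickP => [i //|nk].
have {}nk i : (N %| pos s i - b i)%Z by have := nk i => /negbT; rewrite negbK.
have [k /eqP[]] := bP (dm_val s -
  \sum_j ((pos s j - b j) %/ N)%Z *: dm_val (mm j)).
by rewrite crdB crd_mm divzK // /pos subKr.
Qed.

Lemma k0M s t : (forall i, (N %| pos t i)%Z) -> k0 (dm_mul t s) = k0 s.
Proof.
move=> Nt; rewrite /k0; congr odflt; apply: eq_pick => i.
by rewrite posM -addrA rpredDl.
Qed.

(** The degrees in which e_k belongs to the component of E. *)
Definition inM (k : I) (s : S) : Prop :=
  forall i, b i + (i != k)%:Z <= pos s i.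

(** The difference of the coordinates j and l is a linear form on V vanishing on
every e_k but e_j and e_l; it can be nonzero only in degrees whose coordinates
exceed those of b, equality being allowed at j and l.  If there is a third
index r, equality at both j and l is excluded by the pairs (j, r) and
(l, r). *)
Definition line_mem (v : 'rV[A]_n.+1) : Prop :=
  v 0 0 = 0 /\ forall j l s i, coef s (v 0 j) != coef s (v 0 l) ->
    b i + ((i != j) && (i != l))%:Z <= pos s i.

Lemma line_mem0 : line_mem 0.
Proof. by split=> [|j l s i]; rewrite !mxE // eqxx. Qed.

Lemma line_memD v w : line_mem v -> line_mem w -> line_mem (v + w).
Proof.
move=> [v0 vP] [w0 wP]; split=> [|j l s i]; first by rewrite mxE v0 w0 addr0.
rewrite !mxE !raddfD /=.
have [->|/(vP _ _ _ i)//] := eqVneq (coef s (v 0 j)) (coef s (v 0 l)).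
have [->|/(wP _ _ _ i)//] := eqVneq (coef s (w 0 j)) (coef s (w 0 l)).
by rewrite eqxx.
Qed.

Lemma line_memZ a v : line_mem v -> line_mem (a *: v).
Proof.
move=> [v0 vP]; split=> [|j l s i]; first by rewrite mxE v0 mulr0.
rewrite !mxE -subr_eq0 -raddfB -mulrBr /= => /coefM_neq0[t [t' [_ jl ->]]].
move: jl; rewrite raddfB subr_eq0 => /(vP _ _ _ i) h.
by rewrite posM; have := pos_ge0 t i; lia.
Qed.

Definition line_submodule : submodule 'rV[A]_n.+1 :=
  Submodule line_mem0 line_memD line_memZ.
Local Notation E := (submodule_sort line_submodule).

(** The vector a e_k; the class of the k-th basis vector modulo the diagonal is
normalized by subtracting its coordinate 0 from all coordinates. *)
Definition vec (k : I) (a : A) : 'rV[A]_n.+1 :=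
  \row_j (a *+ (j == k) - a *+ (0 == k)).

Lemma vecE k a j : vec k a 0 j = a *+ (j == k) - a *+ (0 == k).
Proof. by rewrite mxE. Qed.

Lemma vec0 k : vec k 0 = 0.
Proof. by apply/rowP => j; rewrite !mxE !mul0rn subr0. Qed.

Lemma vecD k a a' : vec k (a + a') = vec k a + vec k a'.
Proof. by apply/rowP => j; rewrite !mxE !mulrnDl opprD addrACA. Qed.

Lemma vecZ k a a' : vec k (a * a') = a *: vec k a'.
Proof. by apply/rowP => j; rewrite !mxE mulrBr !mulrnAr. Qed.

Lemma sum_vec (a : I -> A) l : (\sum_k vec k (a k)) 0 l = a l - a 0.
Proof.
rewrite summxE (eq_bigr _ (fun k _ => vecE k (a k) l)) sumrB.
rewrite (bigD1 l) //= eqxx big1 => [|k]; last by rewrite eq_sym => /negbTE->.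
rewrite addr0 (bigD1 ord0) //= big1 => [|k]; last first.
  by rewrite eq_sym => /negbTE->.
by rewrite addr0.
Qed.

Lemma coef_sum_vec (c : I -> K) s t l :
  coef t ((\sum_k vec k (monomial (c k) s)) 0 l) = (c l - c 0) *+ (s == t).
Proof.
rewrite (sum_vec (fun k => monomial (c k) s)).
by rewrite raddfB mulrnBl; congr (_ - _); apply: coef_monomial.
Qed.

Lemma coef_vec k c s t j : coef t (vec k (monomial c s) 0 j) =
  c *+ (s == t) *+ (j == k) - c *+ (s == t) *+ (0 == k).
Proof.
by rewrite vecE raddfB /=; congr (_ - _); rewrite raddfMn /= coef_monomial.
Qed.

Lemma vec_mem k s c : inM k s -> line_mem (vec k (monomial c s)).
Proof.
move=> ks; split=> [|j l t i]; first by rewrite mxE subrr.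
rewrite !mxE !raddfB (inj_eq (addIr _)) !raddfMn /= !coef_monomial.
have [<-{t}|] := eqVneq s t; last by rewrite !mul0rn eqxx.
move=> jl; have := ks i.
have [->|jk] := eqVneq j k; first by case: eqVneq => //=; lia.
have [->|lk] := eqVneq l k; first by case: (eqVneq i k) => //=; lia.
by move: jl; rewrite (negbTE jk) (negbTE lk) eqxx.
Qed.

Definition elt k s c (ks : inM k s) : E := 
  @in_submodule _ _ line_submodule _ (vec_mem c ks).

Lemma elt_val k s c (ks : inM k s) :
  submodule_val (elt c ks) = vec k (monomial c s).
Proof. by []. Qed.

(** The coordinate along e_k of the degree s component of v, in the basis of the
e_k, k != k0 s, of V; it is zero for k = k0 s. *)
Definition phi (v : 'rV[A]_n.+1) (s : S) (k : I) : K :=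
  coef s (v 0 k) - coef s (v 0 (k0 s)).

(** By definition of E the coordinates of s exceed those of b, except at k and
k0 s where they may be equal; at k0 s they are not equal by the choice of
k0 s. *)
Lemma phi_inM v s k : line_mem v -> phi v s k != 0 -> inM k s.
Proof.
rewrite /phi subr_eq0 => -[_ vP] kk0 i; have := vP _ _ _ i kk0.
have [->|ik] //= := eqVneq i k; have [ik0 _|//] := eqVneq i (k0 s).
have := vP _ _ _ i kk0; rewrite ik0 eqxx andbF.
have := k0P s; have [<-|] := eqVneq (b (k0 s)) (pos s (k0 s)).
  by rewrite subrr dvdz0.
lia.
Qed.

Lemma phiD v w s k : phi (v + w) s k = phi v s k + phi w s k.
Proof. by rewrite /phi !mxE !raddfD /= addrACA. Qed.

Lemma phi0 s k : phi 0 s k = 0.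
Proof. by rewrite /phi !mxE subrr. Qed.

Lemma phi_monomial v t s k : (forall i, (N %| pos t i)%Z) ->
  phi (monomial 1 t *: v) (dm_mul t s) k = phi v s k.
Proof.
move=> Nt; rewrite /phi k0M // 2![in LHS]mxE.
by congr (_ - _); rewrite coef_monomialM mul1r.
Qed.

Lemma phi_monomial_neq0 v t s k : (forall i, (N %| pos t i)%Z) ->
  phi (monomial 1 t *: v) s k != 0 ->
  exists2 s', s = dm_mul t s' & phi v s' k != 0.
Proof.
have nz_div j : coef s ((monomial 1 t *: v) 0 j) != 0 ->
    exists s', s = dm_mul t s'.
  by rewrite mxE => /coef_monomialM_neq0[s' -> _]; exists s'.
move=> Nt nz; have [s' sE] : exists s', s = dm_mul t s'.
  apply: contrapT => ndiv; case/eqP: nz; rewrite /phi.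
  have z j : coef s ((monomial 1 t *: v) 0 j) = 0.
    by apply/eqP/negPn/negP => /nz_div.
  by rewrite !z subrr.
by exists s' => //; rewrite -(phi_monomial v s' k Nt) -sE.
Qed.

Lemma line_sum v : line_mem v -> exists r : seq S,
  v = \sum_(s <- r) \sum_k vec k (monomial (phi v s k) s).
Proof.
move=> [v0 _].
pose supp j := projT1 (cid (coef_support (v 0 j))).
pose r := undup (flatten [seq supp j | j : I]).
have r_supp t j : t \notin r -> coef t (v 0 j) = 0.
  apply: contraNeq => /(projT2 (cid (coef_support (v 0 j)))) tj.
  by rewrite mem_undup; apply/flatten_mapP; exists j; rewrite ?mem_enum.
exists r; apply/rowP => l; apply: coefP => t; rewrite summxE raddf_sum /=.
have inner s : coef t ((\sum_k vec k (monomial (phi v s k) s)) 0 l) =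
    coef s (v 0 l) *+ (s == t).
  rewrite (coef_sum_vec (phi v s)) /phi v0 raddf0.
  by rewrite sub0r opprK subrK.
under eq_bigr do rewrite inner.
have [tr|tr] := boolP (t \in r); last first.
  rewrite r_supp // big1_seq // => s /andP[_ sr].
  by have [st|//] := eqVneq s t; rewrite -st sr in tr.
rewrite (bigD1_seq t) ?undup_uniq //= eqxx big1 ?addr0 // => s /negbTE->.
by rewrite mulr0n.
Qed.

(** * Grading and finite generation *)

(** Induction on the decomposition of v in the bases of its graded components; the
generating case keeps the coordinate of v that it comes from. *)
Lemma line_ind (P : E -> Prop) (v : E) : P 0 ->
  (forall x y, P x -> P y -> P (x + y)) ->
  (forall k s c (ks : inM k s), phi (submodule_val v) s k != 0 ->
     P (elt c ks)) ->
  P v.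
Proof.
move=> P0 PD Pelt; have [r vE] := line_sum (submoduleP v).
have term s k : {e : E | submodule_val e =
    vec k (monomial (phi (submodule_val v) s k) s) /\ P e}.
  apply: cid; have [->|ph] := eqVneq (phi (submodule_val v) s k) 0.
    by exists 0; rewrite monomial0 vec0 submodule_val0.
  exists (elt (phi (submodule_val v) s k) (phi_inM (submoduleP v) ph)).
  by split; [|exact: Pelt].
have -> : v = \sum_(s <- r) \sum_k sval (term s k).
  apply: submodule_val_inj; rewrite [LHS]vE submodule_val_sum.
  apply: eq_bigr => s _.
  by rewrite submodule_val_sum; apply: eq_bigr => k _; case: (svalP (term s k)).
elim/big_ind: _ => // s _; elim/big_ind: _ => // k _.
by case: (svalP (term s k)).
Qed.

Definition line_gr (m : 'rV[int]_n.+1) (v : E) : Prop :=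
  forall s j, coef s (submodule_val v 0 j) != 0 -> dm_val s = m.

Lemma line_gr0 m : line_gr m 0.
Proof. by move=> s j; rewrite submodule_val0 mxE raddf0 eqxx. Qed.

Lemma line_grD m x y : line_gr m x -> line_gr m y -> line_gr m (x + y).
Proof.
move=> xm ym s j; rewrite submodule_valD mxE raddfD /=.
have [->|/xm//] := eqVneq (coef s (submodule_val x 0 j)) 0.
by rewrite add0r => /ym.
Qed.

Lemma line_gr_monomial c s m x : line_gr m x ->
  line_gr (dm_val s + m) (monomial c s *: x).
Proof.
move=> xm t j; rewrite submodule_valZ mxE => /coef_monomialM_neq0[t' ->] /xm <-.
by [].
Qed.

Lemma line_gr_elt k s c (ks : inM k s) : line_gr (dm_val s) (elt c ks).
Proof.
move=> t j; rewrite elt_val coef_vec; have [->//|] := eqVneq s t.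
by rewrite !mul0rn subrr eqxx.
Qed.

Lemma line_gr_spans (x : E) : exists2 t : seq E,
  (forall y, y \in t -> exists m, line_gr m y) & x = \sum_(y <- t) y.
Proof.
pose P (z : E) := exists2 t : seq E,
  (forall y, y \in t -> exists m, line_gr m y) & z = \sum_(y <- t) y.
apply: (@line_ind P x).
- by exists [::] => //; rewrite big_nil.
- move=> _ _ [t1 gr1 ->] [t2 gr2 ->].
  exists (t1 ++ t2); last by rewrite big_cat.
  by move=> y0; rewrite mem_cat => /orP[/gr1|/gr2].
- move=> k s c ks _; exists [:: elt c ks]; last by rewrite big_seq1.
  by move=> y0; rewrite inE => /eqP->; exists (dm_val s); apply: line_gr_elt.
Qed.

Lemma line_gr_direct (t : seq 'rV[int]_n.+1) (x : 'rV[int]_n.+1 -> E) :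
  uniq t -> (forall m, line_gr m (x m)) -> \sum_(m <- t) x m = 0 ->
  forall m, m \in t -> x m = 0.
Proof.
move=> ut xgr xsum m mt; apply: submodule_val_inj; rewrite submodule_val0.
apply/rowP => j; apply: coefP => s; rewrite mxE raddf0.
apply: contrapT => /eqP nz; have sm := xgr m s j nz.
have : coef s (submodule_val (\sum_(m <- t) x m) 0 j) = 0.
  by rewrite xsum submodule_val0 mxE raddf0.
rewrite submodule_val_sum summxE raddf_sum /=.
rewrite (bigD1_seq m) //= big1 ?addr0; first by apply/eqP.
move=> m' m'm; apply: contrapT => /eqP /xgr m's.
by rewrite -m's sm eqxx in m'm.
Qed.

Definition line_module : graded_module K sigma :=
  GradedModule line_gr0 line_grD line_gr_monomial line_gr_spans line_gr_direct.

(** Up to a monomial in the mm j, a generator vec k of degree s can be moved to a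
degree at distance less than N from the lower bounds of inM k, and there are
finitely many such degrees. *)
Lemma line_finitely_generated : finitely_generated E.
Proof.
pose B := ((`|N| + \sum_i `|b i|).+1)%N.
(* The generator attached to k and to a vector of coordinates, or 0 if
   no degree of inM k has these coordinates. *)
have gen (x : {ffun I -> 'I_B.+1} * I) : {e : E |
    forall s (ks : inM x.2 s), (forall i, pos s i = (x.1 i)%:Z) -> e = elt 1 ks}.
  apply: cid; have [[s0 [ks0 ps0]]|no] := pselect (exists s0 (ks0 : inM x.2 s0),
    forall i, pos s0 i = (x.1 i)%:Z); last first.
    by exists 0 => s ks ps; case: no; exists s, ks.
  exists (elt 1 ks0) => s ks ps; apply: submodule_val_inj.
  by rewrite !elt_val (@pos_inj s0 s) // => i; rewrite ps0 ps.
pose T := ({ffun I -> 'I_B.+1} * I)%type.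
exists #|{: T}|, (fun i => sval (gen (enum_val i))) => v.
pose P (z : E) := exists a : 'I_#|{: T}| -> A,
  z = \sum_i a i *: sval (gen (enum_val i)).
apply: (@line_ind P v).
- by exists (fun=> 0); rewrite big1 // => i _; rewrite scale0r.
- move=> _ _ [a1 ->] [a2 ->]; exists (fun i => a1 i + a2 i).
  by rewrite -big_split; apply: eq_bigr => i _; rewrite scalerDl.
move=> k s c ks _; pose l i : int := b i + (i != k)%:Z.
pose q i := ((pos s i - l i) %/ N)%Z.
have qN i : q i * N + ((pos s i - l i) %% N)%Z = pos s i - l i.
  by rewrite -divz_eq.
have modN i : 0 <= ((pos s i - l i) %% N)%Z < N.
  by rewrite modz_ge0 ?ltz_pmod // gt_eqF.
have q_ge0 i : 0 <= q i.
  by rewrite divz_ge0 // subr_ge0; apply: ks.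
have [r rE] : exists r : S, dm_val r = \sum_j q j *: dm_val (mm j).
  by apply: dm_of => i; rewrite crd_mm mulr_ge0 // ltW.
have pr i : pos r i = q i * N by rewrite /pos rE crd_mm.
have [s0 s0E] : exists s0, s = dm_mul r s0.
  apply: dm_div => i; rewrite pr.
  have := qN i; have := modN i; have := b_ge0 i; rewrite /l; lia.
have ps0 i : pos s0 i = l i + ((pos s i - l i) %% N)%Z.
  have := posM r s0 i; rewrite -s0E pr; have := qN i; lia.
have ks0 : inM k s0 by move=> i; rewrite ps0 lerDl; case/andP: (modN i).
have s0B i : (`|pos s0 i| < B.+1)%N.
  have : (`|b i| <= \sum_i `|b i|)%N by rewrite (bigD1 i) //= leq_addr.
  have := modN i; have := pos_ge0 s0 i; have := b_ge0 i.
  rewrite ps0 /B /l; lia.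
pose x : {ffun I -> 'I_B.+1} * I := ([ffun i => inord `|pos s0 i|%N], k).
exists (fun i => if i == enum_rank x then monomial c r else 0).
rewrite (bigD1 (enum_rank x)) //= eqxx big1 ?addr0 => [|i /negbTE->]; last first.
  by rewrite scale0r.
rewrite enum_rankK (svalP (gen x) s0 ks0) => [|i]; last first.
  by rewrite ffunE inordK // gez0_abs // pos_ge0.
apply: submodule_val_inj; rewrite submodule_valZ.
by rewrite !elt_val -vecZ monomialM mulr1 -s0E.
Qed.

(** * Rank *)

Lemma deep_exists : exists s : S, forall k, b k + 1 <= pos s k.
Proof.
have [s sE] : exists s : S, dm_val s = \sum_j (b j + 1) *: dm_val (mm j).
  by apply: dm_of => k; rewrite crd_mm; have := b_ge0 k; nia.
by exists s => k; rewrite /pos sE crd_mm; have := b_ge0 k; nia.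
Qed.

Lemma deep_inM s k : (forall i, b i + 1 <= pos s i) -> inM k s.
Proof. by move=> deep i; have := deep i; case: (i != k) => /=; lia. Qed.

Lemma line_lin_indep : exists g : 'I_n -> E, lin_indep g.
Proof.
have [s deep] := deep_exists.
exists (fun j => elt 1 (deep_inM (lift ord0 j) deep)) => a sum0 j.
apply: (@monomial_cancel _ _ _ _ s); rewrite mulr0 mulrC.
have : submodule_val (\sum_i a i *: elt 1 (deep_inM (lift ord0 i) deep)) 0
    (lift ord0 j) = 0 by rewrite sum0 submodule_val0 mxE.
rewrite submodule_val_sum summxE (bigD1 j) //= big1 => [|i ij].
  by rewrite addr0 submodule_valZ elt_val mxE vecE eqxx mulr1n mulr0n subr0.
rewrite submodule_valZ elt_val mxE vecE (inj_eq lift_inj) eq_sym (negbTE ij).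
by rewrite mulr0n subr0 mulr0.
Qed.

Lemma line_rank : has_rank E n.
Proof.
split; first exact: line_lin_indep.
move=> [g g_indep]; pose B := \matrix_(i, j) submodule_val (g i) 0 j.
apply: (@zero_column_not_injective _ _ B) => [i|x xB].
  by rewrite mxE; have [] := submoduleP (g i).
apply/rowP => i; rewrite mxE; apply: (g_indep (fun i => x 0 i)).
apply: submodule_val_inj; rewrite submodule_val_sum submodule_val0.
rewrite -[RHS]xB; apply/rowP => j; rewrite summxE mxE.
by apply: eq_bigr => k _; rewrite submodule_valZ !mxE.
Qed.

(** * Indecomposability *)

(** Primitivity of the j-th ray gives m with j-th coordinate 1; multiples of the
mm k then make the other coordinates of b_j m large. *)
Lemma thin_exists j : exists s : S,
  pos s j = b j /\ forall k, k != j -> b k + 1 <= pos s k.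
Proof.
have [m mj] := Qprim j.
pose C k : int := if k == j then 0 else `|b j * crd m k| + b k + 1.
have sumE k : crd (b j *: m + \sum_i C i *: dm_val (mm i)) k =
    b j * crd m k + C k * N by rewrite crdD crdZ crd_mm.
have geb k : k != j -> b k + 1 <= b j * crd m k + C k * N.
  rewrite /C => /negbTE->; have := b_ge0 k.
  move: (b j * crd m k) => x bk.
  have : 0 <= (`|x| + b k + 1) * (N - 1) by rewrite mulr_ge0 //; lia.
  by rewrite mulrBr mulr1; lia.
have [s sE] : exists s : S, dm_val s = b j *: m + \sum_i C i *: dm_val (mm i).
  apply: dm_of => k; rewrite sumE; have [->|/geb] := eqVneq k j.
    by rewrite mj mulr1 /C eqxx mul0r addr0.
  by have := b_ge0 k; lia.
exists s; rewrite /pos sE; split=> [|k kj]; rewrite sumE ?geb //.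
by rewrite mj mulr1 /C eqxx mul0r addr0.
Qed.

Lemma phi_neq0_coef v s k : phi v s k != 0 -> exists j, coef s (v 0 j) != 0.
Proof.
rewrite /phi; have [->|] := eqVneq (coef s (v 0 k)) 0; last by exists k.
by rewrite sub0r oppr_eq0; exists (k0 s).
Qed.

(** On the j-th wall the component of E is the line of e_j. *)
Lemma line_thin_component j s (x : E) :
  pos s j = b j -> line_gr (dm_val s) x ->
  exists c, submodule_val x = vec j (monomial c s).
Proof.
move=> sj xs.
apply: (@line_ind (fun y => exists c, submodule_val y = vec j (monomial c s)) x).
- by exists 0; rewrite monomial0 vec0 submodule_val0.
- move=> y z [c yc] [c' zc]; exists (c + c').
  by rewrite submodule_valD yc zc -vecD monomialD.
move=> k t c kt nz; exists c; rewrite elt_val.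
have ts : t = s.
  by apply: val_inj; have [l] := phi_neq0_coef nz; apply: xs.
have [<-|jk] := eqVneq k j; first by rewrite ts.
by have := kt j; rewrite eq_sym jk ts sj /=; lia.
Qed.

Lemma line_cancel s (x y : E) :
  monomial 1 s *: x = monomial 1 s *: y -> x = y.
Proof.
move=> xy; apply: submodule_val_inj; apply/rowP => l.
have valZ a (z : E) : submodule_val (a *: z) 0 l = a * submodule_val z 0 l.
  by rewrite submodule_valZ mxE.
apply: (@monomial_cancel _ _ _ _ s); rewrite -(valZ _ x) -(valZ _ y).
by rewrite xy.
Qed.

(** Each vec j in a common degree s is an eigenvector, being a multiple of the
generator of a one-dimensional component; the eigenvalues agree since the sum
of the vec j is zero. *)
Lemma line_endomorphism (f : {linear E -> E}) :
  (forall m x, line_gr m x -> line_gr m (f x)) ->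
  exists c, forall x, f x = monomial c (dm_one sigma) *: x.
Proof.
move=> fgr; have [s0 deep0] := deep_exists.
pose thin j := projT1 (cid (thin_exists j)).
have thinP j : pos (thin j) j = b j /\
    forall k, k != j -> b k + 1 <= pos (thin j) k.
  exact: projT2 (cid (thin_exists j)).
have thin_inM j : inM j (thin j).
  move=> k; have [->|/(thinP j).2//] := eqVneq k j.
  by rewrite (thinP j).1 addr0.
have [s sE] : exists s : S, dm_val s = \sum_j dm_val (thin j) + dm_val s0.
  apply: dm_of => k; rewrite crdD crd_sum addr_ge0 ?pos_ge0 //.
  by apply: sumr_ge0 => j _; apply: pos_ge0.
have ps k : pos s k = \sum_j pos (thin j) k + pos s0 k.
  by rewrite /pos sE crdD crd_sum.
have deep k : b k + 1 <= pos s k.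
  rewrite ps (le_trans (deep0 k)) // lerDr.
  by apply: sumr_ge0 => j _; apply: pos_ge0.
(* s is a multiple of every thin j and exceeds b in all coordinates, so that
   the vectors T j of degree s are multiples of those of degrees thin j. *)
have thin_div j : exists t, s = dm_mul (thin j) t.
  apply: dm_div => k; rewrite ps (bigD1 j) //= -addrA lerDl addr_ge0 ?pos_ge0 //.
  by apply: sumr_ge0 => i _; apply: pos_ge0.
pose T j := elt 1 (deep_inM j deep).
have TE j : submodule_val (T j) = vec j (monomial 1 s) by [].
have eigen j : {c : K | f (T j) = monomial c (dm_one sigma) *: T j}.
  apply: cid; have [t tE] := thin_div j.
  have [c cE] := line_thin_component (thinP j).1
    (fgr _ _ (@line_gr_elt j (thin j) 1 (thin_inM j))).
  exists c; have -> : T j = monomial 1 t *: elt 1 (thin_inM j).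
    apply: submodule_val_inj; rewrite submodule_valZ TE elt_val -vecZ.
    have st : dm_mul t (thin j) = s by rewrite tE; apply: dm_mulC.
    by rewrite monomialX st; reflexivity.
  rewrite linearZ; apply: submodule_val_inj.
  rewrite [RHS]submodule_valZ !submodule_valZ cE elt_val.
  rewrite [RHS]scalerA mulrC -scalerA; congr (_ *: _).
  by rewrite -vecZ monomial1M (mulr1 c).
pose c j := sval (eigen j); have cP j := svalP (eigen j).
have c_eq j : c j = c 0.
  have sumT : \sum_k T k = 0.
    apply: submodule_val_inj; rewrite submodule_val_sum submodule_val0.
    by apply/rowP => l; rewrite (sum_vec (fun=> monomial 1 s)) subrr mxE.
  have : \sum_k f (T k) = 0 by rewrite -linear_sum sumT linear0.
  rewrite (eq_bigr _ (fun k _ => cP k)) => /(congr1 (@submodule_val _ _ _)).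
  rewrite submodule_val_sum submodule_val0.
  under eq_bigr => k _.
    rewrite submodule_valZ TE -vecZ monomial1M (mulr1 (c k)); over.
  move=> /rowP/(_ j); rewrite (sum_vec (fun k => monomial (c k) s)) mxE.
  move=> /subr0_eq/(congr1 (coef s)) cc; have := coef_monomial (c 0) s s.
  by rewrite -cc (coef_monomial (c j)) eqxx.
exists (c 0) => x.
have xT : monomial 1 s *: x = \sum_j submodule_val x 0 j *: T j.
  apply: submodule_val_inj; rewrite submodule_val_sum submodule_valZ.
  under eq_bigr => k _ do rewrite submodule_valZ TE -vecZ.
  apply/rowP => l; rewrite (sum_vec (fun k => submodule_val x 0 k * _)) mxE.
  by rewrite (submoduleP x).1 mul0r subr0 mulrC.
have fxT : monomial 1 s *: f x =
    monomial 1 s *: (monomial (c 0) (dm_one sigma) *: x).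
  apply: (common_eigenvalue _ xT) => j; rewrite -(c_eq j); exact: cP.
exact: (line_cancel fxT).
Qed.

Lemma line_nonzero : (0 < n)%N -> ~ zero_module E.
Proof.
move=> n_gt0 E0; have [g g_indep] := line_lin_indep.
have := g_indep (fun=> 1) (E0 _) (Ordinal n_gt0).
by move/eqP; rewrite oner_eq0.
Qed.

(** The projection to F is a scalar c, so that F is zero if c = 0 and G is zero
otherwise. *)
Lemma line_indecomposable : (0 < n)%N -> indecomposable line_module.
Proof.
move=> n_gt0; split; first exact: line_nonzero.
move=> F G [f [g [fgr ggr fK gK]]].
pose pr (x : E) : E := g ((f x : (F * G)%type).1, 0).
have pr_lin : linear pr := corner_linear f g.
pose prL := GRing.isLinear.Build _ _ _ _ pr pr_lin.
pose prl : {linear E -> E} := HB.pack pr prL.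
have [|c cP] := @line_endomorphism prl.
  move=> m x xm; apply: (ggr m (_, _)); split => /=; last exact: gr0.
  by have [] := fgr m x xm.
have prE x : prl x = g ((f x : (F * G)%type).1, 0) by [].
have [c0|c_neq0] := eqVneq c 0.
  left=> y; have := cP (g (y, 0)).
  rewrite c0 monomial0 scale0r prE gK => /(congr1 f).
  by rewrite gK linear0 => /(congr1 fst).
right=> y; have := cP (g (0, y)); rewrite prE gK linear0 => cy.
have cK : monomial c^-1 (dm_one sigma) * monomial c (dm_one sigma) = 1 :> A.
  by rewrite monomial1M (mulVf c_neq0) monomial1.
have gy0 : g (0, y) = 0 := scale_left_inverse cK (esym cy).
by have := gK (0, y); rewrite gy0 linear0 => /(congr1 snd)/esym.
Qed.

(** * The Cohen-Macaulay property *)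

Definition axis_power (q : nat) (i : nat) : A :=
  monomial 1 (dm_pow (mm (inord i)) q).

Lemma axis_powerE q (j : I) : axis_power q j = monomial 1 (dm_pow (mm j) q).
Proof. by rewrite /axis_power inord_val. Qed.

Lemma pos_mm_pow q j k : pos (dm_pow (mm j) q) k = N *+ q *+ (j == k).
Proof. by rewrite pos_pow mmP -!mulrnA mulnC. Qed.

Lemma dvd_mm_pow q j k : (N %| pos (dm_pow (mm j) q) k)%Z.
Proof. by rewrite pos_mm_pow -mulrnA -mulr_natr dvdz_mulr. Qed.

(** The ideal is generated by monomials, hence is determined by the monomials in
it. *)
Lemma span_toric q t (a : A) : (t <= n.+1)%N ->
  span_seq (axis_power q) t (a : A^o) <->
  forall s, coef s a != 0 -> exists2 j : I, (j < t)%N & N *+ q <= pos s j.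
Proof.
move=> tn; split=> [[f ->] s nz|aP].
  apply: contrapT => no; case/eqP: nz; rewrite raddf_sum big1 // => i _ /=.
  apply/eqP/negPn/negP => /coef_monomialM_neq0[s' sE _]; apply: no.
  have it : (i < n.+1)%N := leq_trans (ltn_ord i) tn.
  exists (inord i); first by rewrite inordK.
  by rewrite sE posM pos_mm_pow eqxx lerDl pos_ge0.
have [r aE] := toric_sum a; rewrite aE big_seq.
elim/big_ind: _ => [|x y|s _]; [exact: span_seq0|exact: span_seqD|].
have [->|/aP[j jt js]] := eqVneq (coef s a) 0.
  rewrite monomial0; exact: span_seq0.
have [s' sE] : exists s', s = dm_mul (dm_pow (mm j) q) s'.
  apply: dm_div => k; rewrite pos_mm_pow; have [<-//|_] := eqVneq j k.
  exact: pos_ge0.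
have -> : monomial (coef s a) s = axis_power q j * monomial (coef s a) s' :> A.
  by rewrite axis_powerE monomialM (mul1r (coef s a)) -sE.
exact: (span_seq_mul (axis_power q) (monomial (coef s a) s') jt).
Qed.

Lemma regular_toric q : regular_on (axis_power q) A^o n.+1.
Proof.
move=> t a tn /(span_toric _ _ (ltnW tn)) taP.
apply/(span_toric _ _ (ltnW tn)) => s sa.
have [|j jt] := taP (dm_mul (dm_pow (mm (inord t)) q) s).
  by rewrite coef_monomialM mul1r.
rewrite posM pos_mm_pow; have [tj|_] := eqVneq (inord t) j.
  by move: jt; rewrite -tj inordK ?ltnn.
by rewrite mulr0n add0r; exists j.
Qed.

Lemma phi_sum (T : Type) (r : seq T) (F : T -> E) s k :
  phi (submodule_val (\sum_(i <- r) F i)) s k =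
  \sum_(i <- r) phi (submodule_val (F i)) s k.
Proof.
by apply: (big_morph (fun x : E => phi (submodule_val x) s k)) => [x y|];
  rewrite ?submodule_valD ?phiD // submodule_val0 phi0.
Qed.

(** Multiplication by a power of mm j shifts the coordinates phi, since k0 does
not change; so membership is read on each coordinate separately. *)
Lemma span_line q t (v : E) : (t <= n.+1)%N ->
  span_seq (axis_power q) t v <->
  forall s k, phi (submodule_val v) s k != 0 -> exists2 j : I, (j < t)%N &
    forall i, b i + (i != k)%:Z + N *+ q *+ (j == i) <= pos s i.
Proof.
move=> tn; split=> [[f ->] s k nz|vP].
  apply: contrapT => no; case/eqP: nz; rewrite phi_sum big1 // => i _ /=.
  apply/eqP/negPn/negP; rewrite submodule_valZ => nz.
  have [s' sE nz'] := phi_monomial_neq0 (dvd_mm_pow q _) nz.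
  have ks := phi_inM (submoduleP (f i)) nz'.
  have it : (i < n.+1)%N := leq_trans (ltn_ord i) tn.
  apply: no; exists (inord i) => [|l]; first by rewrite inordK.
  by rewrite sE posM pos_mm_pow addrC lerD2l; apply: ks.
apply: (@line_ind (fun x => span_seq (axis_power q) t x) v).
- exact: span_seq0.
- by move=> x y; apply: span_seqD.
move=> k s c ks /vP[j jt js].
have [s' sE] : exists s', s = dm_mul (dm_pow (mm j) q) s'.
  apply: dm_div => i; rewrite pos_mm_pow; have := js i; have := b_ge0 i.
  by case: (i != k) => /=; lia.
have ks' : inM k s'.
  by move=> i; have := js i; rewrite sE posM pos_mm_pow addrC lerD2l.
have -> : elt c ks = monomial 1 (dm_pow (mm j) q) *: elt c ks'.
  apply: submodule_val_inj; rewrite submodule_valZ !elt_val -vecZ monomialM.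
  by rewrite mul1r -sE.
by rewrite -axis_powerE; apply: span_seq_mem.
Qed.

(** For j < t a shift in the direction mm t leaves the j-th coordinate of a degree
unchanged, and with it the divisibility by the j-th monomial. *)
Lemma regular_line q : regular_on (axis_power q) E n.+1.
Proof.
move=> t v tn /(span_line _ _ (ltnW tn)) tvP.
apply/(span_line _ _ (ltnW tn)) => s k sk.
have ks := phi_inM (submoduleP v) sk.
have [|j jt js] := tvP (dm_mul (dm_pow (mm (inord t)) q) s) k.
  by rewrite submodule_valZ (phi_monomial _ _ _ (dvd_mm_pow q _)).
exists j => // i; have := js i; rewrite posM pos_mm_pow.
have [<-|_] := eqVneq j i; last by move=> _; rewrite addr0; apply: ks.
have [tj|_] := eqVneq (inord t) j; last by rewrite mulr0n add0r.
by move: jt; rewrite -tj inordK ?ltnn.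
Qed.

(** The filtration of the toric ring by the sum of the coordinates. *)
Definition order_ge (q : nat) (a : A) : Prop :=
  forall s, coef s a != 0 -> q%:Z <= \sum_k pos s k.

Lemma order_geM p q a a' : order_ge p a -> order_ge q a' ->
  order_ge (p + q) (a * a').
Proof.
move=> pa qa s /coefM_neq0[t [t' [/pa ta /qa ta' ->]]].
under eq_bigr do rewrite posM.
by rewrite big_split PoszD lerD.
Qed.

Lemma order_ge0 a : order_ge 0 a.
Proof. by move=> s _; apply: sumr_ge0 => k _; apply: pos_ge0. Qed.

Lemma order_ge_sum q (T : Type) (r : seq T) (F : T -> A) :
  (forall i, order_ge q (F i)) -> order_ge q (\sum_(i <- r) F i).
Proof.
move=> qF; elim/big_ind: _ => // [s|a a' qa qa' s].
  by rewrite raddf0 eqxx.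
rewrite raddfD /=; have [->|/qa//] := eqVneq (coef s a) 0.
by rewrite add0r => /qa'.
Qed.

Lemma fixed_point_order (a : A) : fixed_point_ideal a -> order_ge 1 a.
Proof.
move=> [k [c [g [gP ->]]]]; apply: order_ge_sum => i.
have [s s_neq0 ->] := gP i; apply: (@order_geM 0 1); first exact: order_ge0.
move=> t; rewrite coef_monomial; have [<- _|_] := eqVneq s t; last first.
  by rewrite mulr0n eqxx.
have /existsP[l0 sl0] : [exists l, pos s l != 0].
  apply: contraNT s_neq0 => /existsPn s0; apply/eqP/crd_inj => l.
  have := s0 l; rewrite negbK => /eqP sl.
  by rewrite -/(pos s l) sl /crd mul0mx mxE.
have : 0 < pos s l0 by rewrite lt_def sl0 pos_ge0.
move=> sl; rewrite (bigD1 l0) //= (@le_trans _ _ (pos s l0)) //.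
by rewrite lerDl; apply: sumr_ge0 => l _; apply: pos_ge0.
Qed.

Lemma order_prod (q : nat) (a : 'I_q -> A) :
  (forall i, order_ge 1 (a i)) -> order_ge q (\prod_i a i).
Proof.
elim: q a => [|q IH] a a1; first exact: order_ge0.
by rewrite big_ord_recl; apply: (@order_geM 1 q) => //; apply: IH.
Qed.

(** An element of large order has in each of its degrees a coordinate at least
N q, by the pigeonhole principle, hence lies in the ideal of the sequence. *)
Lemma killed_torsion q (X : lmodType A) (x : X) :
  killed (axis_power q) n.+1 x -> torsion (@fixed_point_ideal K R n.+1 sigma) x.
Proof.
move=> kx; exists (n.+1 * (`|N| * q)).+1%N => a aI; apply: (killed_span kx).
apply/span_toric => // s /(order_prod (fun i => fixed_point_order (aI i))) sq.
apply: contrapT => no; move: sq; apply/negP; rewrite -ltNge.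
have NqE : N *+ q = (`|N| * q)%N%:Z.
  by rewrite -[N in LHS]gez0_abs ?ltW // -mulr_natr natz PoszM.
have small j : pos s j <= (`|N| * q)%N%:Z.
  apply: contrapT => /negP; rewrite -ltNge -NqE => js; apply: no.
  by exists j => //; apply: ltW.
apply: (@le_lt_trans _ _ (\sum_(j < n.+1) (`|N| * q)%N%:Z)); first exact: ler_sum.
by rewrite sumr_const card_ord -mulr_natr natz mulrC -PoszM ltz_nat ltnS.
Qed.

Lemma torsion_killed (X : lmodType A) (x : X) :
  torsion (@fixed_point_ideal K R n.+1 sigma) x ->
  exists q, killed (axis_power q) n.+1 x.
Proof.
move=> [q xq]; exists q => i _.
have := xq (fun=> monomial 1 (mm (inord i))).
rewrite prodr_const card_ord -monomial_pow; apply=> _.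
exists 1%N, (fun=> 1), (fun=> monomial 1 (mm (inord i))).
split=> [_|]; last first.
  by rewrite big_ord1 mul1r.
exists (mm (inord i)) => //; apply/eqP => mm0.
have := mmP (inord i) (inord i).
rewrite /pos mm0 /crd mul0mx mxE eqxx mulr1n => N0.
by move: N_gt0; rewrite -N0.
Qed.

Lemma line_maximal_cohen_macaulay :
  (0 < n)%N -> maximal_cohen_macaulay line_module.
Proof.
move=> n_gt0; split=> [||i id J z /torsion_killed[q kz] dz].
- exact: line_nonzero.
- exact: line_finitely_generated.
have [exact_off _ _ _] :=
  killed_cohomology J (@regular_toric q) (@regular_line q) (leqnn n.+1).
have : boundary (axis_power q) n.+1 z.
  by apply: exact_off => // iE; rewrite iE ltnn in id.
case: i z {id kz dz exact_off} => [//|i] z /= [y ky zy].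
by exists y => //; apply: killed_torsion ky.
Qed.
End LineModule.

(** The rows of the adjugate of Q, up to sign. *)
Lemma coordinate_multiples (d : nat) (Q : 'M[int]_d) : \det Q != 0 ->
  exists (N : int) (m : 'I_d -> 'rV[int]_d), 0 < N /\
    forall j k, (m j *m Q) 0 k = N *+ (j == k).
Proof.
move=> detQ; exists `|\det Q|, (fun j => Num.sg (\det Q) *: row j (\adj Q)).
split=> [|j k]; first by rewrite normr_gt0.
by rewrite -scalemxAl -row_mul mul_adj_mx !mxE mulrnAr normrEsg.
Qed.

Theorem mainTheorem4 (K : fieldType) (R : realType) (d : nat)
    (sigma : cone R d) :
  (3 <= d)%N -> simplicial sigma -> ~ regular sigma ->
  exists E : graded_module K sigma,
    [/\ indecomposable E, maximal_cohen_macaulay E & has_rank E d.-1].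
Proof.
case: d sigma => [//|n] sigma n_ge2 simp nreg.
have n_gt0 : (0 < n)%N by exact: ltnW.
have [Q [dualQ detQ Qprim [b [b_ge0 bP]]]] := nonregular_coordinates simp nreg.
have [N [m [N_gt0 mP]]] := coordinate_multiples detQ.
have mm_ex j : {s : dual_monoid sigma | dm_val s = m j}.
  apply: cid; apply: (dm_of dualQ) => k.
  by rewrite /crd mP; case: (j == k); rewrite // ltW.
pose mm j := sval (mm_ex j).
have mmP j k : pos Q (mm j) k = N *+ (j == k).
  by rewrite /pos (svalP (mm_ex j)) /crd mP.
have bP' x : exists k, crd Q x k != b 0 k.
  apply/existsP; apply: contraNT (bP x) => /existsPn xb.
  by apply/eqP/rowP => k; have := xb k; rewrite negbK => /eqP.
exists (line_module K dualQ detQ N_gt0 mmP bP'); split.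
- exact: (line_indecomposable K dualQ detQ N_gt0 mmP b_ge0 bP' Qprim n_gt0).
- exact: (line_maximal_cohen_macaulay K dualQ detQ N_gt0 mmP b_ge0 bP' n_gt0).
- exact: (line_rank K dualQ detQ N_gt0 mmP b_ge0).
Qed.
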